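(* Let $\mathcal{A}=\langle A;\Xi\rangle$ be an algebra. 1) If $f:A\to A$ is stable preorder preserving then $f^{-1}(L)\in\mathcal{L}_{\mathcal{A}}(L)$ for every $\mathcal{A}$-recognizable $L\subseteq A$. 2) Assume $\mathcal{A}$ is sp-residually finite. If $f:A\to A$ is such that $f^{-1}(L)\in\mathcal{L}_{\mathcal{A}}(L)$ for every $\mathcal{A}$-recognizable $L\subseteq A$, then $f$ is stable preorder preserving.
   Context: Stable relation: $x_i\rho y_i$ for all $i$ implies $\xi(\vec x)\rho\xi(\vec y)$ for every operation $\xi\in\Xi$. Stable preorder: reflexive transitive stable relation, with associated congruence $x\sim y\iff x\preceq y\wedge y\preceq x$. $f$ is stable preorder preserving if $x\preceq y\Rightarrow f(x)\preceq f(y)$ for every stable preorder. $\mathcal{A}$ is sp-residually finite if every stable preorder is an intersection of stable preorders whose associated congruences have finitely many classes. Frozen functions: $x\mapsto\xi(c_1,\ldots,c_{i-1},x,c_{i+1},\ldots,c_m)$ for $\xi\in\Xi$ of arity $m\ge1$ and constants $c_j\in A$; $\mathrm{DUO}(\mathcal{A})$: identity and all finite compositions of frozen functions. $L$ is $\mathcal{A}$-recognizable if $L=\varphi^{-1}(\varphi(L))$ for some surjective morphism $\varphi$ onto a finite algebra of the same signature. $\mathcal{L}_{\mathcal{A}}(L)$: smallest family of subsets of $A$ containing $L$, closed under binary union and intersection and under $\gamma^{-1}$ for all $\gamma\in\mathrm{DUO}(\mathcal{A})$.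
   Formalization: In part 1 the conclusion is claimed only when f^{-1}(L) is neither empty nor all of A; otherwise it fails, e.g. for A with two elements, only the identity operation, L a singleton and f constant, since the lattice uses only binary unions and intersections. *)

(* Defs.v *)
From mathcomp Require Import all_boot.
From mathcomp Require Import boolp classical_sets functions cardinality.

Set Implicit Arguments.
Unset Strict Implicit.
Unset Printing Implicit Defensive.

Local Open Scope classical_set_scope.

Record signature := Signature {
  symb : Type;
  arity : symb -> nat }.

Record algebra (S : signature) := Algebra {
  carrier :> Type;
  op : forall s : symb S, ('I_(arity s) -> carrier) -> carrier }.

Section Algebra.
Variables (S : signature) (A : algebra S).

Definition relation := A -> A -> Prop.

Definition stable (r : relation) : Prop :=
  forall (s : symb S) (x y : 'I_(arity s) -> A),
    (forall i, r (x i) (y i)) -> r (op x) (op y).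

Definition stable_preorder (r : relation) : Prop :=
  [/\ forall x, r x x,
      forall x y z, r x y -> r y z -> r x z
    & stable r].

Definition assoc_congruence (r : relation) : relation :=
  fun x y => r x y /\ r y x.

Definition finitely_many_classes (r : relation) : Prop :=
  finite_set (range (fun x : A => [set y | r x y])).

Definition stable_preorder_preserving (f : A -> A) : Prop :=
  forall r : relation, stable_preorder r ->
    forall x y, r x y -> r (f x) (f y).

Definition sp_residually_finite : Prop :=
  forall r : relation, stable_preorder r ->
    exists P : set relation,
      (forall q, P q ->
         stable_preorder q /\ finitely_many_classes (assoc_congruence q)) /\
      (forall x y, r x y <-> (forall q, P q -> q x y)).

(* The value [c i] is overridden, so only the other coordinates of [c] act as
   constants. *)
Definition frozen (s : symb S) (i : 'I_(arity s)) (c : 'I_(arity s) -> A) :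
    A -> A :=
  fun x => op [eta c with i |-> x].

Inductive DUO : (A -> A) -> Prop :=
| DUO_id : DUO id
| DUO_frozen (s : symb S) (i : 'I_(arity s)) (c : 'I_(arity s) -> A) g :
    DUO g -> DUO (frozen i c \o g).

(* Only binary unions and intersections are involved: the empty set and the
   whole algebra need not belong to the family. *)
Definition lattice_gen (L : set A) : set (set A) :=
  smallest
    (fun F : set (set A) =>
       [/\ setU_closed F, setI_closed F
         & forall g, DUO g -> forall X, F X -> F (g @^-1` X)])
    [set L].

End Algebra.

Definition morphism (S : signature) (A B : algebra S) (phi : A -> B) : Prop :=
  forall (s : symb S) (x : 'I_(arity s) -> A), phi (op x) = op (phi \o x).

Definition recognizable (S : signature) (A : algebra S) (L : set A) : Prop :=
  exists (B : algebra S) (phi : A -> B),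
    [/\ finite_set [set: B], morphism phi, range phi = [set: B]
      & L = phi @^-1` (phi @` L)].

(* Main.v *)
(** Part 1. The syntactic preorder of L, in which x lies below y when every
    gamma in DUO with gamma x in L has gamma y in L, is a stable preorder.
    Hence f respects it, and f^-1(L) is the union, over x in f^-1(L), of the
    intersections of the gamma^-1(L) with gamma x in L. If L is recognized by
    phi then all gamma^-1(L) are preimages under phi, so there are finitely
    many of them, and the union and the intersections are finite. They are
    nonempty as soon as f^-1(L) is neither empty nor everything.

    Part 2. For a stable preorder q of finite index, the up-set L of f x is
    recognized by the quotient of A by the congruence of q. Every member of the
    lattice generated by L is an up-set for q; applying this to f^-1(L), which
    contains x, gives q (f x) (f y) whenever q x y. *)
Require Import Defs.
From mathcomp Require Import all_boot.
From mathcomp Require Import finmap.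
From mathcomp Require Import boolp classical_sets functions cardinality.

Local Open Scope classical_set_scope.

(** * Finite unions and intersections of sets *)

Lemma finite_powerset (T : choiceType) (D : set T) :
  finite_set D -> finite_set [set X | X `<=` D].
Proof.
move=> finD.
apply: (@sub_finite_set _ _
  ((fun Y : {fset T} => [set` Y]) @` [set` fpowerset (fset_set D)])); last first.
  exact/finite_image/finite_fset.
move=> X /= subXD; have finX := sub_finite_set subXD finD.
exists (fset_set X); last exact: fset_setK.
by rewrite /= fpowersetE -fset_set_sub.
Qed.

Lemma finite_bigcup_closed (T : Type) (F G : set (set T)) :
  setU_closed F -> finite_set G -> G !=set0 -> G `<=` F ->
  F (\bigcup_(X in G) X).
Proof.
move=> FU /finite_seqP[s ->]; rewrite bigcup_seq.
elim: s => [|X s IHs]; first by move=> [].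
move=> _ sF; rewrite big_cons.
have FX : F X by apply: sF; rewrite /= mem_head.
(* The tail may be empty, and [F] need not contain the empty union. *)
case: s IHs sF => [|Y s] IHs sF; first by rewrite big_nil setU0.
apply: FU => //; apply: IHs; first by exists Y; rewrite /= mem_head.
by move=> Z /= sZ; apply: sF; rewrite /= in_cons sZ orbT.
Qed.

Lemma finite_bigcap_closed (T : Type) (F G : set (set T)) :
  setI_closed F -> finite_set G -> G !=set0 -> G `<=` F ->
  F (\bigcap_(X in G) X).
Proof.
move=> FI finG [X0 GX0] GF.
(* De Morgan: apply the union case to the family of sets whose complement is in [F]. *)
rewrite -[X in F X]setCK setC_bigcap -(bigcup_image G (@setC T) id).
apply: (@finite_bigcup_closed T [set X | F (~` X)]) => /=.
- by move=> X Y FX FY /=; rewrite setCU; apply: FI.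
- exact: finite_image.
- by exists (~` X0), X0.
- by move=> _ [X GX <-] /=; rewrite setCK; apply: GF.
Qed.

(** * Functions in [DUO] and stability *)

Section Algebras.
Local Set Implicit Arguments.
Local Unset Strict Implicit.
Context {S : signature}.

Lemma DUO_comp (A : algebra S) (g h : A -> A) : DUO g -> DUO h -> DUO (g \o h).
Proof.
move=> Dg Dh; elim: Dg => [|s i c g' _ Dgh]; first exact: Dh.
exact: (DUO_frozen i c Dgh).
Qed.

Lemma DUO_homo (A : algebra S) (r : relation A) g :
  stable_preorder r -> DUO g -> forall x y, r x y -> r (g x) (g y).
Proof.
move=> [rxx _ rst]; elim=> // s i c h _ IHh x y rxy /=.
by apply: rst => j /=; case: eqP => // _; apply: IHh.
Qed.

Lemma morphism_DUO (A B : algebra S) (phi : A -> B) g :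
  morphism phi -> DUO g ->
  forall x y, phi x = phi y -> phi (g x) = phi (g y).
Proof.
move=> mphi; elim=> // s i c h _ IHh x y exy /=.
rewrite !mphi; congr op; apply/funext => j /=.
by case: eqP => // _; apply: IHh.
Qed.

(* The coordinates are changed one at a time. *)
Lemma frozen_stable (A : algebra S) (r : relation A) :
  (forall x, r x x) -> (forall x y z, r x y -> r y z -> r x z) ->
  (forall s (i : 'I_(arity s)) c x y, r x y -> r (frozen i c x) (frozen i c y)) ->
  stable r.
Proof.
move=> rxx rtr rfr s x y rxy.
(* One frozen function, with constants [z k], sends [x k] to [op (z k)] and [y k] to
   [op (z k.+1)]. *)
pose z k (i : 'I_(arity s)) := if i < k then y i else x i.
have step (k : 'I_(arity s)) : r (op (z k)) (op (z k.+1)).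
  have zk : [eta z k with k |-> x k] = z k :> (_ -> _).
    by apply/funext => i /=; case: eqP => // ->; rewrite /z ltnn.
  have zkS : [eta z k with k |-> y k] = z k.+1 :> (_ -> _).
    apply/funext => i /=; rewrite /z (ltnS i k) (leq_eqVlt i k).
    have [->|/negPf neq] := eqVneq i k; first by rewrite eqxx.
    by rewrite (_ : (i == k :> nat) = false).
  by have := rfr s k (z k) _ _ (rxy k); rewrite /frozen zk zkS.
have zP k : k <= arity s -> r (op x) (op (z k)).
  elim: k => [_|k IHk ltk].
    by have -> : z 0 = x by apply/funext.
  exact: rtr (IHk (ltnW ltk)) (step (Ordinal ltk)).
have <- : z (arity s) = y by apply/funext => i; rewrite /z ltn_ord.
exact: zP.
Qed.

Definition syntactic_preorder (A : algebra S) (L : set A) : relation A :=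
  fun x y => forall g, DUO g -> L (g x) -> L (g y).

(** Composing a test function in [DUO] with a frozen function gives another test function, which
    yields stability one coordinate at a time. *)
Lemma syntactic_stable_preorder (A : algebra S) (L : set A) :
  stable_preorder (syntactic_preorder L).
Proof.
have rxx x : syntactic_preorder L x x by [].
have rtr x y z : syntactic_preorder L x y -> syntactic_preorder L y z ->
    syntactic_preorder L x z.
  by move=> xy yz g Dg /(xy g Dg)/(yz g Dg).
split=> //; apply: frozen_stable => // s i c x y xy g Dg.
by have := xy _ (DUO_comp Dg (DUO_frozen i c (DUO_id A))).
Qed.

Lemma finite_DUO_preimage (A : algebra S) (L : set A) :
  recognizable L -> finite_set [set X | exists2 g, DUO g & X = g @^-1` L].
Proof.
move=> [B [phi [finB mphi _ LE]]].
apply: (@sub_finite_set _ _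
  ((fun Y => phi @^-1` Y) @` [set Y : set {classic B} | Y `<=` setT])); last first.
  exact/finite_image/finite_powerset.
move=> _ /= [g Dg ->]; exists (phi @` (g @^-1` L)) => //.
apply/seteqP; split=> [x /= [y Lgy /(morphism_DUO mphi Dg) e]|x Lgx]; last by exists x.
rewrite LE /= -e; exact: (@imageP _ _ phi _ _ Lgy).
Qed.

Lemma lattice_gen_closed (A : algebra S) (L : set A) :
  [/\ setU_closed (lattice_gen L), setI_closed (lattice_gen L)
    & forall g, DUO g -> lattice_gen L (g @^-1` L)].
Proof.
split=> [X Y LX LY F CF|X Y LX LY F CF|g Dg F [[_ _ FD] FL]].
- by have [[FU _ _] _] := CF; apply: FU; [exact: LX|exact: LY].
- by have [[_ FI _] _] := CF; apply: FI; [exact: LX|exact: LY].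
- by apply: FD => //; apply: FL.
Qed.

Lemma lattice_gen_upset (A : algebra S) (r : relation A) (L : set A) :
  stable_preorder r -> (forall x y, r x y -> L x -> L y) ->
  forall X, lattice_gen L X -> forall x y, r x y -> X x -> X y.
Proof.
move=> spr Lup; apply: smallest_sub => [|_ -> //].
split=> [X Y UX UY x y rxy [Xx|Yx]|X Y UX UY x y rxy [Xx Yx]|g Dg X UX x y rxy].
- by left; apply: UX Xx.
- by right; apply: UY Yx.
- by split; [apply: UX Xx|apply: UY Yx].
- exact/UX/(DUO_homo spr Dg).
Qed.

Lemma lattice_gen_preimage (A : algebra S) (f : A -> A) (L : set A) :
  stable_preorder_preserving f -> recognizable L ->
  f @^-1` L <> set0 -> f @^-1` L <> setT -> lattice_gen L (f @^-1` L).
Proof.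
move=> fsp recL fL0 fLT.
have [LU LI LD] := lattice_gen_closed L.
have fup x y : syntactic_preorder L x y -> L (f x) -> L (f y).
  by move=> /(fsp _ (syntactic_stable_preorder L))/(_ _ (DUO_id A)).
pose D := [set X | exists2 g, DUO g & X = g @^-1` L].
have finD : finite_set D by exact: finite_DUO_preimage.
pose G x : set (set A) := [set X | D X /\ X x].
pose U x := \bigcap_(X in G x) X.
have fLE : f @^-1` L = \bigcup_(X in U @` (f @^-1` L)) X.
  rewrite bigcup_image; apply/seteqP; split=> [x Lfx|y [x Lfx Uxy]].
    by exists x => // X [].
  apply: fup Lfx => g Dg Lgx; apply: (Uxy (g @^-1` L)).
  by split=> //; exists g.
rewrite fLE; apply: finite_bigcup_closed => //.
(* [U x] depends only on [G x], a subset of the finite set [D]. *)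
- apply: (@sub_finite_set _ _ ((fun H => \bigcap_(X in H) X) @` [set H | H `<=` D])).
    by move=> _ [x _ <-]; exists (G x) => // X [].
  exact/finite_image/finite_powerset.
- by have /set0P[x Lfx] : f @^-1` L != set0 by [apply/eqP]; exists (U x), x.
- move=> _ [x Lfx <-]; apply: finite_bigcap_closed => //.
  + by apply: sub_finite_set finD => X [].
  + apply: contrapT => G0; apply: fLT; rewrite -subTset => y _.
    apply: fup Lfx => g Dg Lgx; case: G0; exists (g @^-1` L).
    by split=> //; exists g.
  + by move=> _ [[g Dg ->] _]; apply: LD.
Qed.

(** * The quotient by the congruence of a stable preorder *)

Section Quotient.
Variables (A : algebra S) (q : relation A).
Hypothesis spq : stable_preorder q.

Definition cong_class (x : A) : set A := [set y | assoc_congruence q x y].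

Lemma cong_classP x y :
  cong_class x = cong_class y <-> assoc_congruence q x y.
Proof.
have [qxx qtr _] := spq; split=> [exy|[xy yx]].
  by have : cong_class y y; [split; apply: qxx | rewrite -exy].
by apply/seteqP; split=> z [? ?]; split; apply: qtr; eassumption.
Qed.

Definition quotient_carrier : Type := {X : set A | exists x, cong_class x = X}.

Definition quotient_proj (x : A) : quotient_carrier :=
  exist _ (cong_class x) (ex_intro _ x erefl).

Definition quotient_repr (X : quotient_carrier) : A := sval (cid (svalP X)).

Lemma quotient_reprK X : quotient_proj (quotient_repr X) = X.
Proof.
case: X => X pX; apply: eq_exist => /=.
by rewrite /quotient_repr; case: cid.
Qed.

Lemma quotient_projP x y :
  quotient_proj x = quotient_proj y <-> assoc_congruence q x y.
Proof.
rewrite -cong_classP; split=> [[]//|e]; exact: eq_exist.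
Qed.

Definition quotient_algebra : algebra S :=
  @Algebra S quotient_carrier
    (fun s z => quotient_proj (op (quotient_repr \o z))).

(** Stability in both directions makes the operations independent of the chosen representatives. *)
Lemma quotient_proj_morphism :
  morphism (quotient_proj : A -> quotient_algebra).
Proof.
have [_ _ qst] := spq; move=> s x; apply/quotient_projP.
have qx i : assoc_congruence q (x i) (quotient_repr (quotient_proj (x i))).
  by apply/quotient_projP; rewrite quotient_reprK.
by split; apply: qst => i; case: (qx i).
Qed.

Lemma quotient_recognizable (L : set A) :
  finitely_many_classes (assoc_congruence q) ->
  (forall x y, q x y -> L x -> L y) -> recognizable L.
Proof.
move=> finq Lup; exists quotient_algebra, quotient_proj; split.
- apply: (@sub_finite_set _ _ ((fun X : quotient_carrier => sval X) @^-1` range cong_class)).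
    by move=> [X [x xX]] _; exists x.
  apply: finite_preimage finq => -[X pX] [Y pY] _ _ /= e; exact: eq_exist.
- exact: quotient_proj_morphism.
- by rewrite -subTset => X _; exists (quotient_repr X) => //; apply: quotient_reprK.
(* An up-set for [q] is a union of classes, hence saturated. *)
- apply/seteqP; split=> [x Lx|x [y Ly /quotient_projP[yx _]]]; first by exists x.
  exact: Lup yx Ly.
Qed.

End Quotient.

End Algebras.

(* In the first part the two trivial preimages are set apart, because
   [lattice_gen L] may contain neither set0 nor setT, while every constant map
   is stable preorder preserving. *)
Theorem theorem4p11 (S : signature) (A : algebra S) :
  (forall f : A -> A, stable_preorder_preserving f ->
     forall L : set A, recognizable L ->
       f @^-1` L <> set0 -> f @^-1` L <> setT ->
       lattice_gen L (f @^-1` L)) /\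
  (sp_residually_finite A ->
   forall f : A -> A,
     (forall L : set A, recognizable L -> lattice_gen L (f @^-1` L)) ->
     stable_preorder_preserving f).
Proof.
split=> [f fsp L|rf f fL r spr x y rxy]; first exact: lattice_gen_preimage.
have [P [Psp Pr]] := rf r spr; apply/Pr => q Pq.
have [spq finq] := Psp q Pq; have [qxx qtr _] := spq.
have Lup u v : q u v -> [set z | q (f x) z] u -> [set z | q (f x) z] v.
  by move=> uv xu; apply: qtr uv.
have LfL := fL _ (quotient_recognizable spq finq Lup).
(* Reflexivity at [f x] puts [x] in the preimage of its up-set; the up-set property carries this to
   [y]. *)
by apply: (lattice_gen_upset spq Lup LfL) (qxx (f x)); move/Pr: rxy; apply.
Qed.
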